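(* Let $G$ be a $V_5$-free graph with $m\ge 8$ edges. Then \[ \lambda(G)\le \frac{1+\sqrt{4m-3}}{2}, \] and equality holds if and only if $G = K_2\vee \frac{m-1}{2}K_1$ (up to isolated vertices).
   Context: All graphs are finite and simple. $\lambda(G)$ denotes the spectral radius (largest eigenvalue of the adjacency matrix) of $G$. $P_k$ is the path on $k$ vertices, $K_n$ the complete graph, $tK_1$ the edgeless graph on $t$ vertices, and $G\vee H$ the join of $G$ and $H$ (disjoint union plus all edges between $V(G)$ and $V(H)$). The fan graph is $V_k=K_1\vee P_{k-1}$; in particular $V_5=K_1\vee P_4$. A graph is $F$-free if it contains no (not necessarily induced) subgraph isomorphic to $F$. Thus $K_2\vee \frac{m-1}{2}K_1$ (which exists when $m$ is odd) has exactly $m$ edges. *)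

(* Defs.v *)
From HB Require Import structures.
From mathcomp Require Import all_boot all_order all_algebra.
Set Implicit Arguments. Unset Strict Implicit. Unset Printing Implicit Defensive.
Import Order.TTheory GRing.Theory Num.Theory.

Definition simple_graph (n : nat) (e : rel 'I_n) : Prop :=
  (forall u v, e u v = e v u) /\ (forall u, ~~ e u u).

Definition num_edges (n : nat) (e : rel 'I_n) : nat :=
  #|[set p : 'I_n * 'I_n | (p.1 < p.2)%N && e p.1 p.2]|.

Definition adj_mx (R : nzRingType) (n : nat) (e : rel 'I_n) : 'M[R]_n :=
  \matrix_(i, j) ((e i j)%:R)%R.

Definition is_spectral_radius (R : rcfType) (n : nat) (e : rel 'I_n) (l : R)
  : Prop :=
  eigenvalue (adj_mx R e) l /\
  (forall mu : R, eigenvalue (adj_mx R e) mu -> (mu <= l)%R).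

Definition contains_subgraph (k n : nat) (f : rel 'I_k) (e : rel 'I_n) : Prop :=
  exists phi : 'I_k -> 'I_n, injective phi /\
    (forall u v, f u v -> e (phi u) (phi v)).

(* The fan V_5 = K_1 \/ P_4: vertex 0 joined to all of 1,2,3,4, and the
   path 1-2-3-4. *)
Definition V5 : rel 'I_5 :=
  fun u v =>
    (u != v) &&
    [|| (nat_of_ord u == 0%N), (nat_of_ord v == 0%N),
        (nat_of_ord u == (nat_of_ord v).+1) | (nat_of_ord v == (nat_of_ord u).+1)].

Definition K2_join_indep (t : nat) : rel 'I_(t.+2) :=
  fun u v => (u != v) && ((nat_of_ord u < 2)%N || (nat_of_ord v < 2)%N).

(* G is isomorphic to H after deleting isolated vertices of G
   (H itself has no isolated vertices in our use). *)
Definition iso_up_to_isolated (k n : nat) (h : rel 'I_k) (e : rel 'I_n) : Prop :=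
  exists phi : 'I_k -> 'I_n, injective phi /\
    (forall u v, e (phi u) (phi v) = h u v) /\
    (forall w, (forall u, phi u != w) -> forall x, ~~ e w x).

(* Main.v *)
Require Import Defs.
From HB Require Import structures.
From mathcomp Require Import all_boot all_order all_algebra.
From mathcomp Require Import sesquilinear spectral complex ring lra zify.
Set Implicit Arguments. Unset Strict Implicit.
Unset Printing Implicit Defensive.
Import Order.TTheory GRing.Theory Num.Theory.
Local Open Scope ring_scope.

(* Let [x >= 0] be an eigenvector for the spectral radius [l], scaled so that
   its maximum [x u] is [1].  Put [N] for the neighbourhood of [u], [W] for the
   vertices outside [N] and [u], and [d v] for the number of neighbours of [v]
   in [N].  Comparing [l ^ 2 - l] with [m - 1] at [u] gives
     sum_N (d v / 2 - (d v - 1) x v) + sum_W d w (1 - x w) + e(W)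
       = m - (l ^ 2 - l),
   so if [l] reaches the bound then the left-hand side is at most [1].  Since
   [G[N]] has no [P_4], its components are triangles and stars; isolated
   vertices and triangles contribute nonnegative amounts and each star
   contributes at least [1].  If there is a star then every other term
   vanishes, which forces the extremal graph.  Otherwise [N] consists of
   isolated vertices and triangles, a vertex of [W] sees at most one vertex of
   each triangle, and summing the eigenvalue equation over the triangles
   contradicts [l ^ 2 - l >= 7]. *)

(** * A nonnegative eigenvector over a real closed field *)

(** Over the algebraically closed field [complex R] the symmetric matrix has a unitary eigenbasis.
    In its coordinates both quadratic forms are sums of squared moduli, and the comparison is
    termwise. *)
Lemma rayleigh_le (R : rcfType) (n : nat) (A : 'M[R]_n) (l : R) :
  A^T = A -> (forall mu, eigenvalue A mu -> mu <= l) ->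
  forall z : 'rV[R]_n, (z *m A *m z^T) 0 0 <= l * (z *m z^T) 0 0.
Proof.
move=> symA lmax z; pose toC := real_complex R.
pose B := map_mx toC A; pose P := spectralmx B; pose D := spectral_diag B.
have hermB : B \is hermsymmx.
  apply: realsym_hermsym.
    by apply/is_hermitianmxP; rewrite expr0 scale1r map_mx_id // map_trmx symA.
  by apply/mxOverP => i j; rewrite mxE; apply/complex_realP; exists (A i j).
have /orthomx_spectralP BE := hermitian_normalmx hermB.
have uP : P \is unitarymx := spectral_unitarymx B.
have Dreal := hermitian_spectral_diag_real hermB.
(* A diagonal entry is real and has row j of [P] as eigenvector, so it descends to an eigenvalue of
   [A] over [R]. *)
have DE j : exists2 r, D 0 j = toC r & r <= l.
  have /complex_realP[r rE] : D 0 j \is Num.real by apply/mxOverP.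
  exists r => //; apply: lmax.
  suff: eigenvalue B (D 0 j) by rewrite rE eigenvalue_map.
  apply/eigenvalueP; exists (row j P).
    rewrite -row_mul BE !mulmxA mulmxV ?spectral_unit // mul1mx.
    by apply/rowP => k; rewrite mul_diag_mx !mxE.
  apply/eqP => /(congr1 (mulmx^~ (invmx P))).
  rewrite -row_mul mulmxV ?spectral_unit // mul0mx => /rowP/(_ j).
  by rewrite !mxE eqxx => /eqP; rewrite oner_eq0.
pose y := map_mx toC z *m map_mx Num.conj P^T.
have yE : map_mx Num.conj y^T = P *m (map_mx toC z)^T.
  rewrite /y trmx_mul map_mxM !map_trmx trmxK -!map_mx_comp.
  rewrite [X in X *m _]map_mx_id => [|a]; last exact: conjCK.
  congr (_ *m _); apply/matrixP => i j; rewrite !mxE.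
  by apply/CrealP/complex_realP; exists (z j i).
have zAz : toC ((z *m A *m z^T) 0 0) = \sum_j D 0 j * `|y 0 j| ^+ 2.
  have -> : toC ((z *m A *m z^T) 0 0) =
      (y *m diag_mx D *m map_mx Num.conj y^T) 0 0.
    transitivity ((map_mx toC z *m B *m (map_mx toC z)^T) 0 0).
      by rewrite map_trmx -!map_mxM [RHS]mxE.
    by rewrite [in LHS]BE yE /y map_trmx -invmx_unitary // !mulmxA.
  rewrite mxE; apply: eq_bigr => j _.
  by rewrite mul_mx_diag !mxE normCK; ring.
have zz : toC ((z *m z^T) 0 0) = \sum_j `|y 0 j| ^+ 2.
  have -> : toC ((z *m z^T) 0 0) = (y *m map_mx Num.conj y^T) 0 0.
    rewrite yE /y -invmx_unitary // -mulmxA mulKmx ?spectral_unit //.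
    by rewrite map_trmx -map_mxM [RHS]mxE.
  by rewrite mxE; apply: eq_bigr => j _; rewrite !mxE normCK.
suff: toC ((z *m A *m z^T) 0 0) <= toC l * toC ((z *m z^T) 0 0).
  by rewrite -[X in _ <= X]rmorphM lecR.
rewrite zAz zz mulr_sumr; apply: ler_sum => j _.
have [r -> rl] := DE j.
by apply: ler_wpM2r; rewrite ?exprn_ge0 // lecR.
Qed.

(** The form [q] of l - A is positive semidefinite. Taking absolute values in an eigenvector keeps
    its norm and cannot lower the form of the nonnegative matrix [A], so [q] vanishes at [y]; a null
    vector of a semidefinite form lies in its kernel. *)
Lemma nonneg_eigenvector (R : rcfType) (n : nat) (A : 'M[R]_n) (l : R) :
  A^T = A -> (forall i j, 0 <= A i j) -> eigenvalue A l ->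
  (forall mu, eigenvalue A mu -> mu <= l) ->
  exists2 x : 'I_n -> R, (exists i, x i != 0) & 
    (forall i, 0 <= x i) /\ (forall i, l * x i = \sum_j A i j * x j).
Proof.
move=> symA A0 /eigenvalueP[v vA v0] lmax.
have symAE i j : A i j = A j i by rewrite -{1}symA mxE.
have psd := rayleigh_le symA lmax.
pose y : 'rV[R]_n := \row_i `|v 0 i|.
pose q (z w : 'rV[R]_n) := l * (z *m w^T) 0 0 - (z *m A *m w^T) 0 0.
have q0 z : 0 <= q z z by rewrite subr_ge0.
have qy : q y y = 0.
  apply/eqP; rewrite eq_le q0 andbT subr_le0.
  have -> : l * (y *m y^T) 0 0 = (v *m A *m v^T) 0 0.
    rewrite vA -scalemxAl [RHS]mxE; congr (_ * _); rewrite !mxE.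
    by apply: eq_bigr => i _; rewrite !mxE -normrM ger0_norm // -expr2 sqr_ge0.
  rewrite !mxE; apply: ler_sum => j _; rewrite !mxE.
  apply: le_trans (ler_norm _) _; rewrite normrM.
  apply: ler_wpM2r => //; apply: le_trans (ler_norm_sum _ _ _) _.
  by apply: ler_sum => i _; rewrite !mxE normrM (ger0_norm (A0 _ _)).
have qDl a b w : q (a + b) w = q a w + q b w.
  by rewrite /q !mulmxDl ![(_ + _ : 'M_1) 0 0]mxE; ring.
have qZl t a w : q (t *: a) w = t * q a w.
  by rewrite /q -!scalemxAl ![(_ *: _ : 'M_1) 0 0]mxE; ring.
have qC a b : q a b = q b a.
  have ab : a *m b^T = (b *m a^T)^T by rewrite trmx_mul trmxK.
  have aAb : a *m A *m b^T = (b *m A *m a^T)^T.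
    by rewrite !trmx_mul trmxK symA mulmxA.
  by rewrite /q ab aAb [_^T 0 0]mxE [(_ *m A *m _)^T 0 0]mxE.
have qlin w t : q (y + t *: w) (y + t *: w) = 2 * t * q y w + t ^+ 2 * q w w.
  rewrite qDl ![q _ (_ + _)]qC !qDl !(qZl, qC _ (t *: w)) qy (qC w y); ring.
have qyw w : q y w = 0.
  (* The minimising t would divide by [q w w], which may be zero; the shift by 1 avoids this and
     still makes the value negative unless [q y w] is zero. *)
  have c1 : q w w + 1 != 0 by rewrite gt_eqF // ltr_wpDl.
  have := q0 (y + (- (q y w / (q w w + 1))) *: w); rewrite qlin.
  have -> : 2 * - (q y w / (q w w + 1)) * q y w +
      (- (q y w / (q w w + 1))) ^+ 2 * q w w =
      - ((q y w / (q w w + 1)) ^+ 2 * (q w w + 2)).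
    by field.
  rewrite oppr_ge0 pmulr_lle0 ?ltr_wpDl // => h.
  have /eqP : (q y w / (q w w + 1)) ^+ 2 = 0.
    by apply/eqP; rewrite eq_le h sqr_ge0.
  by rewrite sqrf_eq0 mulf_eq0 invr_eq0 (negbTE c1) orbF => /eqP.
exists (fun i => y 0 i).
  have /rV0Pn[i vi] := v0; exists i; rewrite mxE normr_eq0 //.
split=> i; first by rewrite mxE.
have := qyw (delta_mx 0 i).
rewrite /q trmx_delta -!colE !mxE => /eqP; rewrite subr_eq0 => /eqP ->.
by apply: eq_bigr => j _; rewrite symAE mulrC.
Qed.

(** * Numerical estimates for the triangle case *)

(* In the next two lemmas [t] is the number of triangle vertices of [N], [D]
   their total deficit [1 - x], [S] the weight of the isolated vertices of [N],
   [E] the number of edges between [N] and [W], [Q] and [Z] the sums of [x w]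
   and [1 - x w] over these edges, [Y] the part of [Q] coming from triangle
   vertices, and [O] the number of edges inside [W]. *)
Lemma outer_edges_lt2 (R : realFieldType) (t D S O Z Q E l : R) :
  3 <= t -> 0 <= D -> 0 <= S -> 0 <= O -> D + S + Z + O <= 1 ->
  l = t - D + S -> E = Z + Q -> l * Q <= E * (t / 3 + S + O) ->
  0 <= Z -> E < 2.
Proof.
move=> t3 D0 S0 O0 bud lE EE lQ Z0; rewrite ltNge; apply/negP => E2.
have l2 : 2 <= l by lra.
(* If E >= 2, then l Z = l E - l Q is at least 2 (2t/3 - D - O), while the budget caps Z by 1 - D -
   S - O. Together they give t/3 + D + S <= 0. *)
have h1 : l * Z >= 2 * (l - (t / 3 + S + O)).
  have : l * Z = l * E - l * Q by rewrite EE; ring.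
  have : 0 <= (E - 2) * (l - (t / 3 + S + O)) by apply: mulr_ge0; lra.
  nra.
have h2 : l * Z <= l * (1 - S - D - O) by apply: ler_wpM2l; lra.
have h3 : 0 <= (l - 2) * (S + D + O) by apply: mulr_ge0; lra.
lra.
Qed.

Lemma triangle_budget (R : realFieldType) (t D S O Z Q Y E l : R) :
  [\/ t = 0, t = 3 | 6 <= t] -> (t = 0 -> D = 0) ->
  0 <= D -> 0 <= S -> 0 <= O -> 0 <= Z -> 0 <= E <= 1 ->
  D + S + Z + O <= 1 -> l = t - D + S -> E = Z + Q -> Y <= Q ->
  l * Q <= E * (1 + O) -> (l - 2) * (t - D) = t + Y -> 0 <= Q ->
  3 < l -> l ^+ 2 - l < 7.
Proof.
move=> tt t0 D0 S0 O0 Z0 /andP[E0 E1] bud lE EE YQ lQ tri Q0 l3.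
(* As E <= 1, l Q <= E + O = Z + Q + O; now use l > 3. *)
have Q2 : 2 * Q <= Z + O.
  have h1 : 0 <= (l - 3) * Q by apply: mulr_ge0; lra.
  have h2 : 0 <= (1 - E) * O by apply: mulr_ge0; lra.
  lra.
case: tt => [t00|t3|t6].
- by have := t0 t00; lra.
(* Here d = S - D and the goal reads d^2 + 5 d < 1. The budget gives Y <= (1 - d - 2 D) / 2, and
   with [h1] and [h2] this yields d^2 + 6 d <= 1. *)
- pose d := l - 3; have dE : d = l - 3 by [].
  have d0 : 0 < d by lra.
  have h1 : (3 - D) * d = D + Y.
    by move: tri; rewrite t3 (_ : l = d + 3); [lra|rewrite dE; lra].
  have h2 : 0 <= (1 - d - 2 * D) * d by apply: mulr_ge0; lra.
  rewrite (_ : l = d + 3); last by rewrite dE; lra.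
  lra.
(* Now l >= t - D >= 5, so (l - 2)(t - D) >= 3 (t - D), which exceeds t + 1/2 >= t + Y. *)
have h : 0 <= (l - 5) * (t - D - 5) by apply: mulr_ge0; lra.
lra.
Qed.

(** * The link of a vertex *)

Section Link.
Variables (V : finType) (e : rel V).
Hypotheses (e_sym : symmetric e) (e_irr : irreflexive e).
(* The seven edges already make the remaining pairs distinct. *)
Hypothesis fan_free : forall c p q r s, e c p -> e c q -> e c r -> e c s ->
  e p q -> e q r -> e r s -> p != r -> p != s -> q != s -> False.
Variable u : V.

Definition lnk v := [set w | e u w && e v w].
Definition cdeg v := #|lnk v|.
Definition in_tri v := [exists p in lnk v, exists q in lnk v, e p q].

Lemma in_lnk v w : (w \in lnk v) = e u w && e v w.
Proof. by rewrite inE. Qed.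

Lemma edge_neq v w : e v w -> v != w.
Proof. by apply: contraTneq => ->; rewrite e_irr. Qed.

Lemma link_P4_free p q r s : e u p -> e u q -> e u r -> e u s ->
  e p q -> e q r -> e r s -> p != r -> p != s -> q != s -> False.
Proof. exact: fan_free. Qed.

(** A further neighbour y of v would start a path y v p q in G[N]; so triangles are whole
    components. *)
Lemma lnk_triangle v p q : e u v -> e u p -> e u q ->
  e v p -> e v q -> e p q -> lnk v = [set p; q].
Proof.
move=> uv up uq vp vq pq; apply/setP => y; rewrite in_lnk !inE.
apply/andP/orP => [[uy vy]|[]/eqP->//].
have [yp|yp] := eqVneq y p; first by left.
have [yq|yq] := eqVneq y q; first by right.
have [] := @link_P4_free y v p q; rewrite // ?(e_sym y) //.
exact: edge_neq.
Qed.

Lemma in_triP v : e u v -> in_tri v -> exists p q,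
  [/\ lnk v = [set p; q], lnk p = [set v; q], lnk q = [set v; p] &
      [/\ e u p, e u q, e v p, e v q & e p q]].
Proof.
move=> uv /exists_inP[p vp /exists_inP[q vq pq]]; exists p, q.
move: vp vq; rewrite !in_lnk => /andP[up vp] /andP[uq vq].
have pv : e p v by rewrite e_sym.
have qv : e q v by rewrite e_sym.
have qp : e q p by rewrite e_sym.
by split; rewrite //; apply: lnk_triangle.
Qed.

(** The shape of the component of v as seen from v. [LinkLeaf] says only that p has further
    neighbours; applying [linkP] to p then decides the rest. *)
Variant link_spec (v : V) : Prop :=
| LinkIso of cdeg v = 0
| LinkK2 p of lnk v = [set p] & lnk p = [set v]
| LinkLeaf p of lnk v = [set p] & (1 < cdeg p)%N
| LinkCentre of (1 < cdeg v)%N & (forall p, p \in lnk v -> lnk p = [set v])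
| LinkTri of in_tri v.

Lemma linkP v : e u v -> link_spec v.
Proof.
move=> uv; have [c1|c1] := leqP (cdeg v) 1.
  move: c1; rewrite leq_eqVlt ltnS leqn0 => /orP[/cards1P[p vE]|/eqP]; last first.
    exact: LinkIso.
  have [up vp] : e u p /\ e v p by apply/andP; rewrite -in_lnk vE set11.
  have vp' : v \in lnk p by rewrite in_lnk uv e_sym.
  have [c1|] := leqP (cdeg p) 1; last exact: LinkLeaf.
  apply: (LinkK2 vE); apply/esym/eqP; rewrite eqEcard sub1set vp' cards1.
  exact: c1.
have [tri|ntri] := boolP (in_tri v).
  exact: LinkTri.
apply: LinkCentre => // p vp; move: (vp); rewrite in_lnk => /andP[up evp].
apply/setP => y; rewrite in_lnk inE; apply/andP/eqP => [[uy py]|->]; last first.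
  by rewrite uv e_sym.
apply/eqP; apply/negPn/negP => yv.
(* If p had a neighbour y other than v, a second neighbour q of v would give a triangle v p q when y
   = q, and otherwise the path y p v q. *)
have /card_gt0P[q] : (0 < #|lnk v :\ p|)%N.
  by move: c1; rewrite /cdeg (cardsD1 p) vp.
rewrite in_setD1 in_lnk => /and3P[qp uq vq].
have [yq|yq] := eqVneq y q.
  case/negP: ntri; apply/exists_inP; exists p => //.
  by apply/exists_inP; exists q; rewrite ?in_lnk ?uq // -yq.
have [] := @link_P4_free y p v q; rewrite // 1?[e y p]e_sym 1?[e p v]e_sym //.
by rewrite eq_sym.
Qed.

Lemma in_tri_deg v : e u v -> in_tri v -> cdeg v = 2.
Proof.
move=> uv /(in_triP uv)[p [q [vE _ _ [_ _ _ _ pq]]]].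
by rewrite /cdeg vE cards2 edge_neq.
Qed.

Lemma in_tri_lnk v w : e u v -> in_tri v -> w \in lnk v -> in_tri w /\ e u w.
Proof.
move=> uv /(in_triP uv)[p [q [vE pE qE [up uq vp vq pq]]]].
rewrite vE !inE => /orP[]/eqP->; split=> //; apply/exists_inP; exists v;
  rewrite ?pE ?qE ?inE ?eqxx //; apply/exists_inP.
  by exists q; rewrite ?inE ?eqxx ?orbT.
by exists p; rewrite ?inE ?eqxx ?orbT.
Qed.

Definition tri_set := [set v | e u v && in_tri v].

(** Closed neighbourhoods of triangle vertices have three elements and are closed under adjacency,
    so a triangle vertex outside the first one brings a second, disjoint triangle. *)
Lemma card_tri_set : [\/ #|tri_set| = 0, #|tri_set| = 3 | (6 <= #|tri_set|)%N].
Proof.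
have triT v : v \in tri_set -> [/\ #|v |: lnk v| = 3, v |: lnk v \subset tri_set &
    forall z y, z \in v |: lnk v -> y \in lnk z -> y \in v |: lnk v].
  rewrite inE => /andP[uv tri].
  have nvv : v \notin lnk v by rewrite in_lnk e_irr andbF.
  split.
  - by rewrite cardsU1 nvv -/(cdeg v) in_tri_deg.
  - apply/subsetP => z; move=> /setU1P[->|vz]; first by rewrite inE uv.
    by have [tz uz] := in_tri_lnk uv tri vz; rewrite inE uz.
  have [p [q [vE pE qE _]]] := in_triP uv tri; move=> z y.
  move=> /setU1P[->|]; first exact: setU1r.
  rewrite vE => /set2P[]->; rewrite ?pE ?qE !inE => /orP[]->; by rewrite ?orbT.
have [->|[v vT]] := set_0Vmem tri_set; first by constructor 1; rewrite cards0.
have [c3 sub clo] := triT v vT.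
have [TE|[y]] := set_0Vmem (tri_set :\: (v |: lnk v)).
  constructor 2; rewrite -c3; congr #|pred_of_set _|; apply/eqP.
  by rewrite eqEsubset sub -setD_eq0 TE eqxx.
rewrite in_setD => /andP[yv yT]; constructor 3.
have [c3' sub' clo'] := triT y yT.
have dis : [disjoint v |: lnk v & y |: lnk y].
  rewrite disjoint_subset; apply/subsetP => z zv; rewrite inE.
  apply: contraNN yv; rewrite in_setU1 => /orP[/eqP<-//|yz].
  apply: (clo z) => //; move: yz yT; rewrite !in_lnk inE e_sym.
  by move=> /andP[_ zy] /andP[-> _]; rewrite e_sym.
have := subset_leq_card (_ : (v |: lnk v) :|: (y |: lnk y) \subset tri_set).
rewrite cardsU c3 c3' (disjoint_setI0 dis) cards0 subn0; apply.
by rewrite subUset sub sub'.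
Qed.

(** If w sees two vertices a, b of a triangle a b c, then a is the centre of a fan over the path w b
    u c. *)
Lemma outer_tri v w : v \in tri_set -> w != u -> ~~ e u w ->
  (e w v + \sum_(z in lnk v) e w z <= 1)%N.
Proof.
rewrite inE => /andP[uv tri] wu nuw.
have [p [q [vE _ _ [up uq vp vq pq]]]] := in_triP uv tri.
rewrite vE big_setU1 ?inE ?edge_neq //= big_set1.
have notboth a b c : e u a -> e u b -> e u c -> e a b -> e a c -> e b c ->
    e w a -> e w b -> False.
  move=> ua ub uc ab ac bc wa wb.
  apply: (@fan_free a w b u c); rewrite // 1?(e_sym a w) 1?(e_sym a u) 1?(e_sym b u) //.
    by apply: contraNneq nuw => ->.
  exact: edge_neq.
have := notboth _ _ _ uv up uq vp vq pq.
have := notboth _ _ _ uv uq up vq vp; rewrite e_sym => /(_ pq).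
have := notboth _ _ _ up uq uv pq; rewrite 2![e _ v]e_sym => /(_ vp vq).
by case: (e w v) (e w p) (e w q) => [] [] [] // h1 h2 h3; case: (h1, h2, h3);
  case; auto.
Qed.

(** * The weighted count of edges *)

Section Weights.
Variables (R : realFieldType) (x : V -> R) (l : R).
Local Notation a v w := ((e v w)%:R : R).
Local Notation W w := ((w != u) && ~~ e u w).
Hypotheses (x_ge0 : forall v, 0 <= x v) (x_le1 : forall v, x v <= 1).
Hypotheses (x_u : x u = 1) (eig : forall v, l * x v = \sum_w a v w * x w).

(** The number of edges, written through degrees because [V] carries no order. *)
Definition half_degree_sum : R := (\sum_v \sum_w a v w) / 2.
Definition wdeg v : R := \sum_(w | W w) a v w.
Definition big_deg v : R := (1 < cdeg v)%N%:R.
(* Each edge of [G[N]] is shared between its ends with shares summing to [1],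
   and a vertex of degree at least [2] takes all of it from a leaf; this puts
   the excess of a star at its centre. *)
Definition excess v : R :=
  \sum_(w in lnk v) (1 + big_deg v - big_deg w) / 2 - ((cdeg v)%:R - 1) * x v.

Lemma sum_split (F : V -> R) :
  \sum_v F v = F u + \sum_(v | e u v) F v + \sum_(v | W v) F v.
Proof.
rewrite (bigD1 u) //= (bigID (e u)) /= addrA; congr (_ + _ + _).
by apply: eq_bigl => v; have [->|] := eqVneq v u; rewrite ?e_irr.
Qed.

Lemma sum_lnk v (F : V -> R) :
  \sum_(w | e u w) a v w * F w = \sum_(w in lnk v) F w.
Proof.
rewrite [LHS]big_mkcond [RHS]big_mkcond; apply: eq_bigr => w _; rewrite in_lnk.
by case: (e u w) (e v w) => [] []; rewrite ?mul1r ?mul0r.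
Qed.

Lemma cdegE v : (cdeg v)%:R = \sum_(w | e u w) a v w.
Proof.
under eq_bigr => w _ do rewrite -[a v w]mulr1.
by rewrite sum_lnk sumr_const.
Qed.

Lemma sum_adj v (F : V -> R) : \sum_w a v w * F w =
  a v u * F u + \sum_(w in lnk v) F w + \sum_(w | W w) a v w * F w.
Proof. by rewrite sum_split sum_lnk. Qed.

Lemma l_sum : l = \sum_(v | e u v) x v.
Proof.
rewrite -[l]mulr1 -x_u eig [RHS]big_mkcond; apply: eq_bigr => v _.
by case: ifP; rewrite ?mul1r ?mul0r.
Qed.

(** The eigenvalue equation used twice from u: [cdeg w] counts the walks of length two from u to
    w. *)
Lemma l_sqr : l ^+ 2 = \sum_w (cdeg w)%:R * x w.
Proof.
rewrite expr2 [X in l * X]l_sum mulr_sumr.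
under eq_bigr => v _ do rewrite eig.
rewrite exchange_big; apply: eq_bigr => w _; rewrite cdegE mulr_suml.
by apply: eq_bigr => v _; rewrite e_sym.
Qed.

(** The correction to an equal sharing of the edges is antisymmetric in their ends and cancels in
    the sum. *)
Lemma sum_excess : \sum_(v | e u v) excess v =
  \sum_(v | e u v) ((cdeg v)%:R / 2 - ((cdeg v)%:R - 1) * x v).
Proof.
rewrite !sumrB; congr (_ - _).
pose h v w : R := a v w * (big_deg v - big_deg w).
have h0 : \sum_(v | e u v) \sum_(w | e u w) h v w = 0.
  have hN : \sum_(v | e u v) \sum_(w | e u w) h v w =
    - \sum_(v | e u v) \sum_(w | e u w) h v w.
    rewrite {1}exchange_big -sumrN; apply: eq_bigr => v _.
    by rewrite -sumrN; apply: eq_bigr => w _; rewrite /h e_sym; ring.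
  lra.
transitivity (\sum_(v | e u v) ((cdeg v)%:R / 2 +
    \sum_(w | e u w) h v w / 2)); last first.
  rewrite big_split /=; under [X in _ + X]eq_bigr do rewrite -mulr_suml.
  by rewrite -!mulr_suml h0 mul0r addr0.
apply: eq_bigr => v _; rewrite -sum_lnk cdegE mulr_suml -big_split /=.
by apply: eq_bigr => w _; rewrite /h; ring.
Qed.

(** Edges are sorted into those at u, inside N, between N and W, and inside W. The term of [l_sqr]
    at u is the degree of u and cancels the first class. *)
Lemma excess_identity :
  \sum_(v | e u v) excess v + \sum_(w | W w) (cdeg w)%:R * (1 - x w) +
    (\sum_(w | W w) wdeg w) / 2 = half_degree_sum - (l ^+ 2 - l).
Proof.
have cu : (cdeg u)%:R = \sum_(v | e u v) (1 : R).
  by rewrite cdegE; apply: eq_bigr => v ->.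
have degE v : \sum_w a v w = a v u + (cdeg v)%:R + wdeg v.
  by rewrite sum_split cdegE.
have wu : wdeg u = 0.
  by rewrite /wdeg big1 // => w /andP[_ /negbTE->].
have NW : \sum_(v | e u v) wdeg v = \sum_(w | W w) (cdeg w)%:R.
  rewrite exchange_big; apply: eq_bigr => w _; rewrite cdegE.
  by apply: eq_bigr => v _; rewrite e_sym.
have sG : half_degree_sum = (\sum_(v | e u v) (1 : R)) +
    (\sum_(v | e u v) (cdeg v)%:R) / 2 + \sum_(w | W w) (cdeg w)%:R +
    (\sum_(w | W w) wdeg w) / 2.
  rewrite /half_degree_sum (eq_bigr _ (fun v _ => degE v)) sum_split e_irr wu cu.
  have -> : \sum_(v | e u v) (a v u + (cdeg v)%:R + wdeg v) =
      \sum_(v | e u v) (1 + (cdeg v)%:R + wdeg v).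
    by apply: eq_bigr => v uv; rewrite e_sym uv.
  have -> : \sum_(v | W v) (a v u + (cdeg v)%:R + wdeg v) =
      \sum_(v | W v) ((cdeg v)%:R + wdeg v).
    by apply: eq_bigr => v /andP[_ /negbTE uv]; rewrite e_sym uv add0r.
  by rewrite !big_split /= NW; field.
rewrite sum_excess sG l_sqr l_sum [\sum_w _ * x w]sum_split x_u cu.
rewrite !sumrB -mulr_suml.
have -> : \sum_(v | e u v) ((cdeg v)%:R - 1) * x v =
    \sum_(v | e u v) ((cdeg v)%:R * x v - x v).
  by apply: eq_bigr => v _; ring.
have -> : \sum_(v | W v) (cdeg v)%:R * (1 - x v) =
    \sum_(v | W v) ((cdeg v)%:R - (cdeg v)%:R * x v).
  by apply: eq_bigr => v _; ring.
by rewrite !sumrB; ring.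
Qed.

(** * Reaching the bound: components of the link that exhaust the budget *)

Hypotheses (l_gt3 : 3 < l) (gap : half_degree_sum - 1 <= l ^+ 2 - l).

Lemma x_gt0 v : e u v -> 0 < x v.
Proof.
move=> uv; have l_gt0 : 0 < l by apply: lt_trans l_gt3.
rewrite -(pmulr_rgt0 _ l_gt0).
rewrite eig (bigD1 u) //= e_sym uv x_u mulr1 ltr_pwDl // sumr_ge0 // => w _.
by rewrite mulr_ge0.
Qed.

Lemma excess_iso v : cdeg v = 0 -> excess v = x v.
Proof.
by move=> c0; rewrite /excess c0 (cards0_eq c0) big_set0; ring.
Qed.

Lemma excess_K2 v p : lnk v = [set p] -> lnk p = [set v] -> excess v = 1 / 2.
Proof.
by move=> vE pE; rewrite /excess /big_deg /cdeg vE big_set1 pE !cards1 /=; field.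
Qed.

Lemma excess_leaf v p : lnk v = [set p] -> (1 < cdeg p)%N -> excess v = 0.
Proof.
move=> vE c1; rewrite /excess /big_deg vE big_set1 c1 /cdeg vE cards1 /=.
by field.
Qed.

(** The centre is credited with all d edges of its star, so its excess is d - (d - 1) x v with x v
    <= 1. *)
Lemma excess_centre v : (1 < cdeg v)%N ->
  (forall p, p \in lnk v -> lnk p = [set v]) -> 1 <= excess v.
Proof.
move=> c1 vE; rewrite /excess (eq_bigr (fun _ => 1)) => [|p /vE pE]; last first.
  by rewrite /big_deg c1 /cdeg pE cards1 /=; field.
have := x_le1 v; rewrite sumr_const -/(cdeg v).
have : 1 <= (cdeg v)%:R :> R by rewrite ler1n ltnW.
by nra.
Qed.

Lemma excess_tri v : e u v -> in_tri v -> excess v = 1 - x v.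
Proof.
move=> uv tri; rewrite /excess (eq_bigr (fun _ => 1 / 2)) => [|p vp].
  by rewrite sumr_const -/(cdeg v) in_tri_deg //; field.
have [trip up] := in_tri_lnk uv tri vp.
by rewrite /big_deg !in_tri_deg //=; field.
Qed.

Lemma excess_ge0 v : e u v -> 0 <= excess v.
Proof.
move=> uv; case: (linkP uv) => [/excess_iso->|p vE /(excess_K2 vE)->|p vE c1||].
- exact: x_ge0.
- by lra.
- by rewrite (excess_leaf vE c1).
- by move=> c1 vE; apply: le_trans (excess_centre c1 vE).
by move=> /(excess_tri uv)->; rewrite subr_ge0.
Qed.

Lemma outer_ge0 w : 0 <= (cdeg w)%:R * (1 - x w).
Proof. by rewrite mulr_ge0 // subr_ge0. Qed.

Lemma wdeg_ge0 w : 0 <= wdeg w.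
Proof. exact: sumr_ge0. Qed.

(** By [gap] the nonnegative terms of [excess_identity] sum to at most 1; a set S that already takes
    1 leaves zero for all others. *)
Lemma tight (S : {set V}) : (forall v, v \in S -> e u v) ->
  1 <= \sum_(v in S) excess v ->
  [/\ half_degree_sum - 1 = l ^+ 2 - l, forall v, e u v -> v \notin S -> excess v = 0,
      forall w, W w -> (0 < cdeg w)%N -> x w = 1 &
      forall w w', W w -> W w' -> ~~ e w w'].
Proof.
move=> SN S1; have := excess_identity; rewrite (bigID (mem S)) /=.
have -> : \sum_(v | e u v && (v \in S)) excess v = \sum_(v in S) excess v.
  by apply: eq_bigl => v; case: (boolP (v \in S)) => [/SN->|]; rewrite ?andbF.
set B := \sum_(v | _ && _) excess v; set Z := \sum_(w | _) (_ * _).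
set O := \sum_(w | _) wdeg w => idn.
have restN v : e u v && (v \notin S) -> 0 <= excess v.
  by move=> /andP[uv _]; apply: excess_ge0.
have B0 : 0 <= B by apply: sumr_ge0.
have Z0 : 0 <= Z by apply: sumr_ge0 => w _; apply: outer_ge0.
have O0 : 0 <= O by apply: sumr_ge0 => w _; apply: wdeg_ge0.
have [Bz Zz Oz] : [/\ B = 0, Z = 0 & O = 0] by have := gap; split; lra.
split=> [|v uv vS|w wW cw|w w' wW w'W].
- by have := gap; lra.
- by apply: (psumr_eq0P restN Bz); rewrite uv.
- have /eqP := psumr_eq0P (fun w _ => outer_ge0 w) Zz wW.
  by rewrite mulf_eq0 pnatr_eq0 eqn0Ngt cw /= subr_eq0 => /eqP.
have wd0 := psumr_eq0P (fun w _ => wdeg_ge0 w) Oz wW.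
have /eqP := psumr_eq0P (fun w' _ => ler0n _ (e w w')) wd0 w'W.
by rewrite pnatr_eq0 eqb0.
Qed.

(** The equation at w writes l as the sum of x over the neighbours of w in N. By [l_sum] all of N
    also gives l, and x is positive there, so no vertex is missing. *)
Lemma tight_outer w : (forall w w', W w -> W w' -> ~~ e w w') ->
  W w -> x w = 1 -> forall v, e u v -> e w v.
Proof.
move=> noW wW xw v uv; apply/negPn/negP => nwv.
have : l = \sum_(v | e u v) a w v * x v.
  have := eig w; rewrite xw mulr1 sum_split; case/andP: (wW) => _ nuw.
  rewrite [e w u]e_sym (negbTE nuw) mul0r add0r.
  rewrite [X in _ + X]big1 ?addr0 // => w' w'W.
  by rewrite (negbTE (noW _ _ wW w'W)) mul0r.
apply/eqP; rewrite gt_eqF // [X in _ < X]l_sum.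
rewrite (bigD1 v) //= [X in _ < X](bigD1 v) //= (negbTE nwv) mul0r add0r.
rewrite ltr_pwDl ?x_gt0 //; apply: ler_sum => z _.
by case: (e w z); rewrite ?mul1r ?mul0r.
Qed.

(** Triangle vertices would have weight 1, so l > 3 forces an outer neighbour w of v. By
    [tight_outer] w sees all of N, and v is then the centre of a fan over u p w q. *)
Lemma tight_no_tri (S : {set V}) :
  (forall v, e u v -> v \notin S -> excess v = 0) ->
  (forall w, W w -> (0 < cdeg w)%N -> x w = 1) ->
  (forall w w', W w -> W w' -> ~~ e w w') ->
  (forall v, v \in S -> ~~ in_tri v) ->
  forall v, e u v -> ~~ in_tri v.
Proof.
move=> SN xW noW ST v uv; apply/negP => tri.
have tri1 z : e u z -> in_tri z -> x z = 1.
  move=> uz tz; have /SN := uz => /(_ (contraL (ST z) tz)).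
  by rewrite excess_tri // => /eqP; rewrite subr_eq0 => /eqP.
have [p [q [vE pE qE [up uq vp vq pq]]]] := in_triP uv tri.
have [tp _] : in_tri p /\ e u p by apply: (in_tri_lnk uv tri); rewrite vE !inE eqxx.
have [tq _] : in_tri q /\ e u q by apply: (in_tri_lnk uv tri); rewrite vE !inE eqxx orbT.
have := eig v; rewrite sum_adj e_sym uv vE big_setU1 ?inE ?edge_neq //= big_set1.
rewrite x_u (tri1 v) ?(tri1 p) ?(tri1 q) //.
rewrite big1 => [|w wW]; first by have := l_gt3; lra.
have [vw|] := boolP (e v w); last by rewrite mul0r.
have cw : (0 < cdeg w)%N.
  by apply/card_gt0P; exists v; rewrite in_lnk uv e_sym.
have allN := tight_outer noW wW (xW w wW cw); case/andP: wW => wu nuw.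
have [] := @fan_free v u p w q; rewrite // 1?[e v u]e_sym 1?[e p w]e_sym ?allN //.
- by rewrite eq_sym.
- exact: edge_neq.
exact: edge_neq.
Qed.

(** Without triangles only leaves of stars have excess zero, and a star centre has excess at least
    1, hence lies in S. *)
Lemma tight_leaf (S : {set V}) :
  (forall v, e u v -> v \notin S -> excess v = 0) ->
  (forall v, e u v -> ~~ in_tri v) ->
  forall y, e u y -> y \notin S ->
  exists q, [/\ q \in S, lnk y = [set q] & (1 < cdeg q)%N].
Proof.
move=> SN noT y uy yS; have := SN y uy yS; case: (linkP uy).
- by move=> /excess_iso-> x0; have := x_gt0 uy; rewrite x0 ltxx.
- by move=> p yE /(excess_K2 yE)-> /eqP; rewrite mul1r invr_eq0 pnatr_eq0.
- move=> q yE cq _; exists q; split=> //; apply/negPn/negP => qS.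
  have uq : e u q.
    by have : q \in lnk y; [rewrite yE set11 | rewrite in_lnk => /andP[]].
  have := SN q uq qS; case: (linkP uq).
  + by move=> c0; rewrite c0 in cq.
  + by move=> z qE; rewrite /cdeg qE cards1 in cq.
  + by move=> z qE; rewrite /cdeg qE cards1 in cq.
  + by move=> c1 /(excess_centre c1) + q0; rewrite q0 // ler10.
  by rewrite (negbTE (noT _ uq)).
- by move=> c1 /(excess_centre c1) + y0; rewrite y0 ler10.
by rewrite (negbTE (noT _ uy)).
Qed.

(** The two ends use up the budget with 1/2 each. Any other vertex of N would be a leaf at v or p,
    whose degrees are 1; so N is the pair and l <= 2. *)
Lemma no_K2 v p : e u v -> lnk v = [set p] -> lnk p = [set v] -> False.
Proof.
move=> uv vE pE.
have [up vp] : e u p /\ e v p by apply/andP; rewrite -in_lnk vE set11.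
have cv : cdeg v = 1 by rewrite /cdeg vE cards1.
have cp : cdeg p = 1 by rewrite /cdeg pE cards1.
have [||_ SN xW noW] := @tight [set v; p].
- by move=> z /set2P[]->.
- rewrite big_setU1 ?inE ?edge_neq //= big_set1.
  by rewrite (excess_K2 vE pE) (excess_K2 pE vE); lra.
have ST z : z \in [set v; p] -> ~~ in_tri z.
  move=> /set2P[]->; apply/negP => /in_tri_deg; rewrite ?cv ?cp => c2.
    by have := c2 uv.
  by have := c2 up.
have noT := tight_no_tri SN xW noW ST.
have : l <= x v + x p.
  rewrite l_sum (bigD1 v) //= (bigD1 p) /= ?up 1?eq_sym ?edge_neq //.
  rewrite big1 ?addr0 // => y /andP[/andP[uy yv] yp].
  have yS : y \notin [set v; p] by rewrite !inE negb_or yv.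
  by have [q [/set2P[]-> _]] := tight_leaf SN noT uy yS; rewrite ?cv ?cp.
by have := (x_le1 v, x_le1 p, l_gt3) => -[[]]; lra.
Qed.

Lemma centre_structure c : e u c -> (1 < cdeg c)%N ->
  (forall p, p \in lnk c -> lnk p = [set c]) ->
  [/\ half_degree_sum - 1 = l ^+ 2 - l, forall i, e u i -> i != c -> e c i,
      forall i, e c i -> i != u -> e u i &
      forall i j, e i j -> (i \in [set u; c]) || (j \in [set u; c])].
Proof.
move=> uc c1 cE.
have [||sG SN xW noW] := @tight [set c].
- by move=> z /set1P->.
- by rewrite big_set1 excess_centre.
have ST z : z \in [set c] -> ~~ in_tri z.
  move=> /set1P->; apply/exists_inP => -[p cp] /exists_inP[q cq pq].
  move: (cq); rewrite in_lnk => /andP[uq _].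
  have : q \in lnk p by rewrite in_lnk uq.
  by rewrite (cE p cp) inE => /eqP qc; move: cq; rewrite qc in_lnk e_irr andbF.
have noT := tight_no_tri SN xW noW ST.
(* An outer vertex with a neighbour in N would see all of N, giving a fan with centre c over p u q w
   for two leaves p, q. *)
have cW w : W w -> cdeg w = 0.
  move=> wW; apply/eqP; rewrite eqn0Ngt; apply/negP => cw.
  have allN := tight_outer noW wW (xW w wW cw); case/andP: wW => wu nuw.
  have [p [q [cp cq pq]]] := card_gt1P c1.
  move: cp cq; rewrite !in_lnk => /andP[up ecp] /andP[uq ecq].
  have [] := @fan_free c p u q w; rewrite // 1?[e c u]e_sym 1?[e c w]e_sym
    1?[e p u]e_sym 1?[e q w]e_sym ?allN //.
  - by apply: contraNneq nuw => <-.
  by rewrite eq_sym.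
have nWN v w : W w -> e u v -> ~~ e v w.
  move=> wW uv; apply/negP => vw; have := cW w wW; apply/eqP.
  by rewrite -lt0n; apply/card_gt0P; exists v; rewrite in_lnk uv e_sym.
have leaf y : e u y -> y != c -> lnk y = [set c].
  move=> uy yc; have yS : y \notin [set c] by rewrite inE.
  by have [q [/set1P-> ->]] := tight_leaf SN noT uy yS.
split=> // [i ui ic|i ci iu|i j ij].
- have : c \in lnk i by rewrite leaf // set11.
  by rewrite in_lnk [e i _]e_sym => /andP[].
- by apply/negPn/negP => nui; apply: (negP (nWN c i _ uc)); rewrite ?iu.
rewrite !inE; have [//|iu /=] := eqVneq i u; have [//|ic /=] := eqVneq i c.
have [//|ju /=] := eqVneq j u; apply/negPn/negP => jc.
have [ui|nui] := boolP (e u i); have [uj|nuj] := boolP (e u j).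
- have : j \in lnk i by rewrite in_lnk uj.
  by rewrite leaf // inE (negbTE jc).
- by apply: (negP (nWN i j _ ui)); rewrite ?ju.
- by apply: (negP (nWN j i _ uj)); rewrite ?iu // e_sym.
by apply: (negP (noW i j _ _)); rewrite ?iu ?ju.
Qed.

(** * Links made of isolated vertices and triangles *)

Lemma wdeg_le w : W w -> wdeg w <= (\sum_(w' | W w') wdeg w') / 2.
Proof.
move=> wW; rewrite ler_pdivlMr // mulr_natr mulr2n (bigD1 w) //= lerD2l.
(* The remaining summands count each edge at w once more, from its far end. *)
rewrite /wdeg (bigD1 w) //= e_irr add0r; apply: ler_sum => w' /andP[w'W _].
by rewrite (bigD1 w) //= e_sym lerDl sumr_ge0.
Qed.

(** Each triangle vertex is counted by exactly the two other vertices of its triangle. *)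
Lemma sum_tri_set_lnk (F : V -> R) :
  \sum_(v in tri_set) \sum_(w in lnk v) F w = 2 * \sum_(w in tri_set) F w.
Proof.
under eq_bigr => v _ do rewrite -sum_lnk.
rewrite exchange_big /= mulr_sumr.
transitivity (\sum_(w | e u w) (if w \in tri_set then 2 * F w else 0)); last first.
  rewrite -big_mkcondr; apply: eq_bigl => w; rewrite inE.
  by case: (e u w).
apply: eq_bigr => w uw; rewrite -mulr_suml; case: ifPn => wT.
  congr (_ * _); move: (wT); rewrite inE => /andP[_ tw].
  transitivity ((cdeg w)%:R : R); last by rewrite in_tri_deg.
  rewrite cdegE [LHS]big_mkcond [RHS]big_mkcond.
  apply: eq_bigr => v _; rewrite e_sym; have [wv|_] := boolP (e w v); last first.
    by rewrite !if_same.
  rewrite inE; have [uv|//] := boolP (e u v); rewrite /=.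
  by have [->] : in_tri v /\ e u v by apply: (in_tri_lnk uw tw); rewrite in_lnk uv.
rewrite big1 ?mul0r // => v; rewrite inE => /andP[uv tv].
have [vw|//] := boolP (e v w); case/negP: wT; rewrite inE uw.
by have [->] : in_tri w /\ e u w by apply: (in_tri_lnk uv tv); rewrite in_lnk uw.
Qed.

(** Summing [outer_tri] over all triangle vertices counts each adjacency of w three times. *)
Lemma outer_tri_set w : W w -> \sum_(v in tri_set) a w v <= #|tri_set|%:R / 3.
Proof.
move=> /andP[wu nuw]; rewrite ler_pdivlMr //.
have -> : (\sum_(v in tri_set) a w v) * 3 =
    \sum_(v in tri_set) (a w v + \sum_(z in lnk v) a w z).
  by rewrite big_split /= sum_tri_set_lnk; ring.
rewrite -sum1_card natr_sum; apply: ler_sum => v vT.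
by rewrite -natr_sum -natrD ler_nat outer_tri.
Qed.

Lemma iso_tri_bound : (forall v, e u v -> cdeg v = 0 \/ in_tri v) ->
  l ^+ 2 - l < 7.
Proof.
move=> NT; pose D := \sum_(v in tri_set) (1 - x v).
pose S := \sum_(v | e u v && ~~ in_tri v) x v.
pose Z := \sum_(w | W w) (cdeg w)%:R * (1 - x w).
pose Q := \sum_(w | W w) (cdeg w)%:R * x w.
pose E := (\sum_(w | W w) cdeg w)%N.
pose O := (\sum_(w | W w) wdeg w) / 2.
pose Y := \sum_(v in tri_set) \sum_(w | W w) a v w * x w.
pose t : R := #|tri_set|%:R.
have inT v : (v \in tri_set) = e u v && in_tri v by rewrite inE.
have TD : \sum_(v in tri_set) x v = t - D.
  by rewrite /D sumrB sumr_const /t; ring.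
have splitN (F : V -> R) : \sum_(v | e u v) F v =
    \sum_(v in tri_set) F v + \sum_(v | e u v && ~~ in_tri v) F v.
  by rewrite (bigID in_tri) /=; under [in RHS]eq_bigl do rewrite inT.
have lE : l = t - D + S by rewrite l_sum splitN TD.
have D0 : 0 <= D by apply: sumr_ge0 => v _; rewrite subr_ge0.
have S0 : 0 <= S by apply: sumr_ge0.
have Z0 : 0 <= Z by apply: sumr_ge0 => w _; apply: outer_ge0.
have Q0 : 0 <= Q by apply: sumr_ge0 => w _; rewrite mulr_ge0.
have O0 : 0 <= O by rewrite divr_ge0 // sumr_ge0 // => w _; apply: wdeg_ge0.
have EE : E%:R = Z + Q.
  rewrite /E natr_sum /Z /Q -big_split /=; apply: eq_bigr => w _; ring.
have bud : D + S + Z + O <= 1.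
  have := excess_identity; rewrite splitN -/Z -/O.
  have -> : \sum_(v in tri_set) excess v = D.
    by apply: eq_bigr => v; rewrite inT => /andP[uv tv]; apply: excess_tri.
  have -> : \sum_(v | e u v && ~~ in_tri v) excess v = S.
    apply: eq_bigr => v /andP[uv /negbTE ntv]; apply: excess_iso.
    by case: (NT v uv); rewrite ?ntv.
  by have := gap; lra.
have YQ : Y <= Q.
  rewrite /Y exchange_big; apply: ler_sum => w _.
  rewrite -mulr_suml ler_wpM2r // cdegE splitN.
  under eq_bigr => v _ do rewrite e_sym.
  by rewrite lerDl sumr_ge0.
(* Sum of the eigenvalue equations over the triangle vertices: u contributes t, the triangles 2 (t -
   D), and W contributes Y. *)
have tri : (l - 2) * (t - D) = t + Y.
  have : l * (t - D) = t + 2 * (t - D) + Y.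
    rewrite -TD -sum_tri_set_lnk mulr_sumr /t -sum1_card natr_sum /Y -!big_split /=.
    apply: eq_bigr => v; rewrite inT => /andP[uv _].
    by rewrite eig sum_adj e_sym uv x_u mulr1.
  lra.
have outer w : W w -> l * x w = \sum_(v | e u v) a w v * x v +
    \sum_(w' | W w') a w w' * x w'.
  by move=> /andP[_ /negbTE nuw]; rewrite eig sum_split e_sym nuw mul0r add0r.
have outerW w : W w -> \sum_(w' | W w') a w w' * x w' <= O.
  move=> wW; apply: le_trans (wdeg_le wW); apply: ler_sum => w' _.
  by rewrite ler_piMr.
have lQ (F : V -> R) : (forall w, W w -> (0 < cdeg w)%N -> l * x w <= F w) ->
    l * Q <= \sum_(w | W w) (cdeg w)%:R * F w.
  move=> xF; rewrite /Q mulr_sumr; apply: ler_sum => w wW; rewrite mulrCA.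
  by have [->|c0] := posnP (cdeg w); rewrite ?mul0r // ler_wpM2l // xF.
have sumE (c : R) : \sum_(w | W w) (cdeg w)%:R * c = E%:R * c.
  by rewrite -mulr_suml -natr_sum.
have tcase : [\/ t = 0, t = 3 | 6 <= t].
  rewrite /t; case: card_tri_set => [->|->|c6]; first by constructor 1.
    by constructor 2.
  by constructor 3; rewrite ler_nat.
have t0D : t = 0 -> D = 0.
  by move=> /eqP; rewrite pnatr_eq0 cards_eq0 => /eqP T0; rewrite /D T0 big_set0.
(* First a crude estimate of l x w by t/3 + S + O. Once E <= 1 is known, w has at most one neighbour
   in N and 1 + O suffices. *)
have E1 : (E <= 1)%N.
  rewrite -ltnS -(ltr_nat R); have [t0|t3] : t = 0 \/ 3 <= t by case: tcase; lra.
    by have := l_gt3; have := t0D t0; lra.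
  apply: (outer_edges_lt2 t3 D0 S0 O0 bud lE EE) => //; rewrite -sumE.
  apply: lQ => w wW _; rewrite outer // splitN.
  apply: lerD (outerW w wW); apply: lerD.
    apply: le_trans (outer_tri_set wW); apply: ler_sum => v _.
    by rewrite ler_piMr.
  apply: ler_sum => v _.
  by rewrite -[leRHS]mul1r ler_wpM2r // lern1 leq_b1.
apply: (triangle_budget tcase t0D D0 S0 O0 Z0 _ bud lE EE YQ _ tri Q0 l_gt3).
  by rewrite ler0n lern1.
rewrite -sumE; apply: lQ => w wW _; rewrite outer //.
apply: lerD (outerW w wW); apply: (@le_trans _ _ (cdeg w)%:R).
  by rewrite cdegE; apply: ler_sum => v _; rewrite ler_piMr.
rewrite lern1; apply: leq_trans E1; rewrite /E (bigD1 w) //=; exact: leq_addr.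
Qed.

Lemma extremal_structure : 7 <= l ^+ 2 - l ->
  exists2 c, e u c &
  [/\ half_degree_sum - 1 = l ^+ 2 - l, forall i, e u i -> i != c -> e c i,
      forall i, e c i -> i != u -> e u i &
      forall i j, e i j -> (i \in [set u; c]) || (j \in [set u; c])].
Proof.
move=> l7; pose centre c := [&& e u c, (1 < cdeg c)%N &
  [forall p in lnk c, lnk p == [set c]]].
have centreE c : e u c -> (1 < cdeg c)%N ->
    (forall p, p \in lnk c -> lnk p = [set c]) -> centre c.
  move=> uc c1 cE; rewrite /centre uc c1; apply/forall_inP => p /cE/eqP; exact.
have [c /and3P[uc c1 /forall_inP cE]|noC] := pickP centre.
  exists c => //; apply: centre_structure => // p /cE/eqP; exact.
suff : l ^+ 2 - l < 7 by rewrite ltNge l7.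
apply: iso_tri_bound => v uv; case: (linkP uv).
- by left.
- by move=> p vE /(no_K2 uv vE).
- move=> p vE c1.
  have [up vp] : e u p /\ e v p by apply/andP; rewrite -in_lnk vE set11.
  case: (linkP up) => [c0|q pE|q pE|_ pE|tp].
  + by rewrite c0 in c1.
  + by rewrite /cdeg pE cards1 in c1.
  + by rewrite /cdeg pE cards1 in c1.
  + by have := noC p; rewrite centreE.
  (* A neighbour in N of a triangle vertex lies in the same triangle. *)
  right; have [//] : in_tri v /\ e u v.
    by apply: (in_tri_lnk up tp); rewrite in_lnk uv e_sym.
- by move=> c1 vE; have := noC v; rewrite centreE.
by right.
Qed.

End Weights.
End Link.

(** * Reading off the extremal graph *)

Lemma V5_free_fan (n : nat) (e : rel 'I_n) :
  symmetric e -> irreflexive e -> ~ contains_subgraph V5 e ->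
  forall c p q r s, e c p -> e c q -> e c r -> e c s ->
  e p q -> e q r -> e r s -> p != r -> p != s -> q != s -> False.
Proof.
move=> e_sym e_irr free c p q r s cp cq cr cs pq qr rs pr ps qs; apply: free.
have neq v w : e v w -> v != w by apply: contraTneq => ->; rewrite e_irr.
pose P := [:: c; p; q; r; s].
have uP : uniq P.
  by rewrite /= !inE !negb_or !(neq c) //
    !(neq _ _ pq, neq _ _ qr, neq _ _ rs) pr ps qs.
exists (fun i => nth c P i); split=> [i j /eqP|i j].
  by rewrite nth_uniq // => /eqP/val_inj.
case: i => [[|[|[|[|[|//]]]]] ?]; case: j => [[|[|[|[|[|//]]]]] ?] //= _;
  by rewrite // e_sym.
Qed.

Lemma sum_adj_edges (n : nat) (e : rel 'I_n) : symmetric e -> irreflexive e ->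
  (\sum_v \sum_w e v w = (num_edges e).*2)%N.
Proof.
move=> e_sym e_irr.
pose g (v w : 'I_n) : nat := (v < w)%N && e v w.
have gE : num_edges e = (\sum_v \sum_w g v w)%N.
  rewrite pair_big /= /num_edges -sum1_card big_mkcond /=.
  by apply: eq_bigr => -[v w] _; rewrite inE /g /=; case: (_ && _).
rewrite -addnn {2}gE [in RHS]exchange_big gE -big_split /=; apply: eq_bigr => v _.
rewrite -big_split; apply: eq_bigr => w _; rewrite /g [e w v]e_sym.
by case: ltngtP => [_|_|/val_inj->]; rewrite /= ?e_irr ?addn0.
Qed.

(** * Books: the spine is the edge u c, the pages are the vertices of [L] *)

Section BookStructure.
Variables (n : nat) (e : rel 'I_n) (u c : 'I_n).
Hypotheses (e_sym : symmetric e) (e_irr : irreflexive e) (uc : e u c).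
Hypotheses (u_c : forall i, e u i -> i != c -> e c i).
Hypotheses (c_u : forall i, e c i -> i != u -> e u i).
Hypothesis (cover : forall i j, e i j -> (i \in [set u; c]) || (j \in [set u; c])).

Let L := [set v | e u v && (v != c)].

Lemma adj_book v w : e v w = [&& v != w, (v \in [set u; c]) || (w \in [set u; c]),
  v \in [set u; c] :|: L & w \in [set u; c] :|: L].
Proof.
have adj_u i : e u i -> i \in [set u; c] :|: L.
  by move=> ui; rewrite !inE ui; case: (i == c); rewrite ?orbT.
have adj_c i : e c i -> i \in [set u; c] :|: L.
  move=> ci; have [->|iu] := eqVneq i u; first by rewrite !inE eqxx.
  exact/adj_u/c_u.
have hub i j : i \in [set u; c] -> j \in [set u; c] :|: L -> i != j -> e i j.
  move=> /set2P[]->; rewrite !inE.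
    by case/orP=> [/orP[]/eqP->|/andP[]//]; rewrite ?eqxx.
  case/orP=> [/orP[]/eqP->|/andP[uj jc _]]; rewrite ?eqxx //; first by rewrite e_sym.
  exact: u_c.
have hubs i : i \in [set u; c] -> i \in [set u; c] :|: L.
  by move=> h; apply/setUP; left.
apply/idP/and4P => [vw|[nvw /orP[vh vL wL|wh vL wL]]].
- have nvw : v != w by apply: contraTneq vw => ->; rewrite e_irr.
  have wv : e w v by rewrite e_sym.
  split=> //; first exact: cover.
    by case/orP: (cover vw) => [/hubs//|/set2P[] h]; rewrite h in wv; auto.
  by case/orP: (cover vw) => [/set2P[] h|/hubs//]; rewrite h in vw; auto.
- exact: hub.
by rewrite e_sym hub // eq_sym.
Qed.

(** Handshake count: u and c have degree |L| + 1, vertices of [L] have degree 2, all others 0. *)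
Lemma num_edges_book : num_edges e = (#|L|.*2).+1.
Proof.
have uL : u \notin L by rewrite inE e_irr.
have cL : c \notin L by rewrite inE eqxx andbF.
have nuc : u != c by apply: contraTneq uc => <-; rewrite e_irr.
apply: double_inj; rewrite -sum_adj_edges //.
have deg v : (\sum_w e v w = #|[set w | e v w]|)%N.
  by rewrite -sum1dep_card [RHS]big_mkcond; apply: eq_bigr => w _;
    case: (e v w).
under eq_bigr => v _ do rewrite deg.
rewrite (bigD1 u) //= (bigD1 c) 1?eq_sym //=.
have -> : [set w | e u w] = c |: L.
  apply/setP => w; rewrite !inE; have [->|_] := eqVneq w c; first by rewrite uc.
  by rewrite andbT.
have -> : [set w | e c w] = u |: L.
  apply/setP => w; rewrite !inE; have [->|wu] := eqVneq w u; first by rewrite e_sym uc.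
  apply/idP/andP => [cw|[uw wc]]; last exact: u_c.
  by split; [exact: c_u | apply: contraTneq cw => ->; rewrite e_irr].
rewrite !cardsU1 uL cL (bigID (mem L)) /=.
rewrite (eq_bigl (mem L)) => [|v]; last first.
  by apply: andb_idl => vL; apply/andP; split; apply: contraTneq vL => ->.
rewrite (eq_bigr (fun _ => 2%N)) => [|v vL]; last first.
  transitivity #|[set u; c]|; last by rewrite cards2 nuc.
  congr #|pred_of_set _|; apply/setP => w; rewrite inE adj_book.
  move: vL; rewrite !inE => /andP[uv vc]; rewrite uv vc orbT.
  have vu : v == u = false by apply: contraTF uv => /eqP->; rewrite e_irr.
  rewrite vu (negbTE vc) /=.
  have [->|] := eqVneq w u; rewrite ?vu //=; have [->|] := eqVneq w c; rewrite ?vc //=.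
  by rewrite !andbF.
rewrite sum_nat_const big1 => [|v /andP[/andP[vu vc] vL]]; last first.
  apply/eqP; rewrite cards_eq0; apply/eqP/setP => w; rewrite inE adj_book.
  by rewrite !in_setU !in_set1 (negbTE vu) (negbTE vc) (negbTE vL) !andbF inE.
by move: #|L| => k; lia.
Qed.

Lemma iso_book : iso_up_to_isolated (@K2_join_indep #|L|) e.
Proof.
(* The spine comes first, to match the indices below 2 in [K2_join_indep]. *)
pose s := u :: c :: enum L.
have ss : size s = #|L|.+2 by rewrite /= -cardE.
have us : uniq s.
  rewrite /= enum_uniq andbT inE !mem_enum !inE e_irr eqxx andbF orbF andbT.
  by apply: contraTneq uc => <-; rewrite e_irr.
have ltis (i : 'I_#|L|.+2) : (i < size s)%N by rewrite ss.
have inj : injective (fun i : 'I_#|L|.+2 => nth u s i).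
  by move=> i j /eqP; rewrite nth_uniq // => /eqP/val_inj.
have mem_s v : (v \in s) = (v \in [set u; c] :|: L).
  by rewrite !inE mem_enum inE orbA.
have hub (i : 'I_#|L|.+2) : (nth u s i \in [set u; c]) = (i < 2)%N.
  have -> : [set u; c] = [set v in take 2 s] 
    by apply/setP => v; rewrite /s /= take0 !inE.
  rewrite inE in_take ?mem_nth // index_uniq //.
exists (fun i => nth u s i); split=> //; split=> [i j|w nw x].
  by rewrite adj_book !hub -!mem_s !mem_nth // !andbT /K2_join_indep (inj_eq inj).
rewrite adj_book -!mem_s; apply/and4P => -[_ _ ws _].
have iw : (index w s < #|L|.+2)%N by rewrite -ss index_mem.
by have /eqP[] := nw (Ordinal iw); rewrite /= nth_index.
Qed.
End BookStructure.

Lemma book_eigenvalue (R : realFieldType) (n t : nat) (e : rel 'I_n) (l : R) :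
  symmetric e -> iso_up_to_isolated (@K2_join_indep t) e ->
  l != 0 -> l ^+ 2 = l + 2 * t%:R -> eigenvalue (adj_mx R e) l.
Proof.
move=> e_sym [phi [phi_inj [phiE phi_out]]] l0 lE.
(* Eigenvector of the book: the equation at a spine vertex is l^2 = l + 2 t, at a page 2 l = l + l.
   The sum in [x] transports it along [phi] and is zero off the image. *)
pose g (i : 'I_t.+2) : R := if (i < 2)%N then l else 2.
pose x (w : 'I_n) : R := \sum_i (phi i == w)%:R * g i.
have x_phi i : x (phi i) = g i.
  rewrite /x (bigD1 i) //= eqxx mul1r big1 ?addr0 // => j ji.
  by rewrite (inj_eq phi_inj) (negbTE ji) mul0r.
have gE j : \sum_i g i * (K2_join_indep i j)%:R = l * g j.
  rewrite 2!big_ord_recl (eq_bigr (fun _ => 2 * (j < 2)%N%:R)) => [|i _].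
    rewrite sumr_const card_ord /g /K2_join_indep -mulr_natr.
    case: j => [[|[|j]] jlt] /=; rewrite ?mulr0 ?mul0r ?mulr1 -?expr2 ?lE; ring.
  rewrite /g /K2_join_indep /=; congr (_ * _%:R).
  by case: j => [[|[|j]] jlt]; rewrite ?andbF.
apply/eigenvalueP; exists (\row_w x w); last first.
  apply/eqP => /rowP/(_ (phi ord0)); rewrite !mxE x_phi /g /=.
  by move/eqP; rewrite (negbTE l0).
apply/rowP => w; rewrite !mxE.
transitivity (\sum_i g i * (e (phi i) w)%:R).
  transitivity (\sum_v \sum_i ((phi i == v)%:R * g i) * (e v w)%:R).
    by apply: eq_bigr => v _; rewrite !mxE mulr_suml.
  rewrite exchange_big; apply: eq_bigr => i _.
  rewrite (bigD1 (phi i)) //= eqxx mul1r big1 ?addr0 // => v vi.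
  by rewrite eq_sym (negbTE vi) !mul0r.
have [j /eqP<-|nw] := pickP (fun i => phi i == w).
  by rewrite x_phi -gE; apply: eq_bigr => i _; rewrite phiE.
rewrite /x !big1 ?mulr0 // => i _; first by rewrite nw mul0r.
by rewrite e_sym (negbTE (phi_out w _ _)) ?mulr0 // => k; rewrite nw.
Qed.

Lemma spectral_extremal (R : rcfType) (n : nat) (e : rel 'I_n) (l : R) :
  simple_graph e -> ~ contains_subgraph V5 e -> (8 <= num_edges e)%N ->
  is_spectral_radius e l -> 3 < l -> (num_edges e)%:R - 1 <= l ^+ 2 - l ->
  [/\ l ^+ 2 - l = (num_edges e)%:R - 1, odd (num_edges e) &
      iso_up_to_isolated (@K2_join_indep (num_edges e).-1./2) e].
Proof.
move=> [e_sym e_irr'] free m8 [l_eig l_max] l3 gap.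
have e_irr : irreflexive e by move=> v; apply/negbTE.
have symA : (adj_mx R e)^T = adj_mx R e.
  by apply/matrixP => i j; rewrite !mxE e_sym.
have A0 i j : 0 <= adj_mx R e i j by rewrite mxE.
have [x [i0 xi0] [x_ge0 x_eig]] := nonneg_eigenvector symA A0 l_eig l_max.
(* The base vertex carries the maximal weight; dividing by it gives values in [0, 1] with 1 at u. *)
pose u := [arg max_(i > i0) x i]%O.
have x_le v : x v <= x u by rewrite /u; case: arg_maxP => // i _ imax; exact: imax.
have xu0 : 0 < x u.
  by apply: lt_le_trans (x_le i0); rewrite lt_neqAle eq_sym xi0 x_ge0.
pose y v := x v / x u.
have sizeE : half_degree_sum e R = (num_edges e)%:R.
  have -> : half_degree_sum e R = (\sum_v \sum_w e v w)%N%:R / 2.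
    by rewrite natr_sum; congr (_ / _); apply: eq_bigr => v _; rewrite natr_sum.
  by rewrite sum_adj_edges // -muln2 natrM mulfK ?pnatr_eq0.
have y_ge0 v : 0 <= y v by rewrite divr_ge0.
have y_le1 v : y v <= 1 by rewrite ler_pdivrMr // mul1r.
have y_u : y u = 1 by rewrite /y divff // gt_eqF.
have y_eig v : l * y v = \sum_w (e v w)%:R * y w.
  rewrite /y mulrA x_eig mulr_suml; apply: eq_bigr => w _.
  by rewrite mxE mulrA.
have l7 : 7 <= l ^+ 2 - l.
  apply: le_trans gap; have : 8 <= (num_edges e)%:R :> R by rewrite ler_nat.
  lra.
have gap' : half_degree_sum e R - 1 <= l ^+ 2 - l by rewrite sizeE.
have [c uc [lE u_c c_u cover]] := extremal_structure e_sym e_irr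
  (V5_free_fan e_sym e_irr free) y_ge0 y_le1 y_u y_eig l3 gap' l7.
have mE := num_edges_book e_sym e_irr uc u_c c_u cover.
have iso := iso_book e_sym e_irr uc u_c c_u cover.
split; first by rewrite -sizeE.
  by rewrite mE /= odd_double.
by rewrite mE /= doubleK.
Qed.

Theorem theorem1p4 (R : rcfType) (n : nat) (e : rel 'I_n) (l : R) :
  simple_graph e ->
  ~ contains_subgraph V5 e ->
  (8 <= num_edges e)%N ->
  is_spectral_radius e l ->
  l <= (1 + Num.sqrt (4 * (num_edges e)%:R - 3)) / 2 /\
  (l = (1 + Num.sqrt (4 * (num_edges e)%:R - 3)) / 2 <->
     odd (num_edges e) /\
     iso_up_to_isolated (@K2_join_indep (num_edges e).-1./2) e).
Proof.
move=> simple free m8 rad.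
set m := num_edges e; set b := (1 + _) / 2.
have mR : 8 <= m%:R :> R by rewrite ler_nat.
have s_sqr : Num.sqrt (4 * m%:R - 3) ^+ 2 = 4 * m%:R - 3 :> R.
  by rewrite sqr_sqrtr //; lra.
have s_ge0 : 0 <= Num.sqrt (4 * m%:R - 3) :> R by apply: sqrtr_ge0.
(* For m >= 8 the radicand is at least 29 > 25; this is what makes b exceed 3. *)
have s_gt5 : 5 < Num.sqrt (4 * m%:R - 3) :> R by nra.
have b3 : 3 < b by rewrite /b; lra.
have bE : b ^+ 2 - b = m%:R - 1 by rewrite /b; move: s_sqr; lra.
(* Both claims follow from this: l > b is absurd since it yields l = b, and l = b yields the
   structure. *)
have extr : b <= l -> [/\ l = b, odd m &
    iso_up_to_isolated (@K2_join_indep m.-1./2) e].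
  move=> bl; have l3 : 3 < l by lra.
  have gap : m%:R - 1 <= l ^+ 2 - l by rewrite -bE; nra.
  have [lE om iso] := spectral_extremal simple free m8 rad l3 gap.
  split=> //; apply/eqP; rewrite eq_le bl andbT leNgt; apply/negP => lb.
  by move: lE; rewrite -bE; nra.
have lb : l <= b.
  rewrite leNgt; apply/negP => bl; have [lE _ _] := extr (ltW bl).
  by rewrite lE ltxx in bl.
split=> //; split=> [lE|[om iso]]; first by case: extr; rewrite ?lE.
(* By maximality of l it is enough that b is an eigenvalue. *)
apply/eqP; rewrite eq_le lb; case: rad => _; apply.
apply: (book_eigenvalue simple.1 iso); first by rewrite gt_eqF; lra.
have -> : 2 * (m.-1./2)%:R = m%:R - 1 :> R; last by lra.
(* Oddness of m makes the halving exact. *)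
have mE : m = (2 * m.-1./2 + 1)%N by lia.
by rewrite [in RHS]mE natrD natrM addrK.
Qed.
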